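(* Let $n\ge3$, $m\ge2$. For every integer $k>0$ and every $r\in\mathbb{Z}/n\mathbb{Z}$, the quantum loop elementary symmetric function $e_k^{(r)}(\mathbf{q}_1,\dots,\mathbf{q}_m)$ belongs to $\mathcal{Q}_\epsilon^{\mathfrak{S}_m}$.
   Context: Second (equivalently, upper) indices are taken in $\mathbb{Z}/n\mathbb{Z}$, $\epsilon$ is a central indeterminate, and we write $q_j^{(i)}=q_{j,i}$. For $k\in\mathbb{Z}/n\mathbb{Z}$ let $S_k$ be the set of $q_{j,i}$ with $i+j\equiv1+k\pmod n$. $\mathcal{Q}_\epsilon=\mathbb{Q}_\epsilon\langle\mathbf{q}_1,\dots,\mathbf{q}_m\rangle$, $\mathbf{q}_j=(q_{j,i})_{i}$, is the skew field of fractions of the quantum torus over $\mathbb{Z}[\epsilon,\epsilon^{-1}]$ generated by the $q_{j,i}^{\pm1}$ ($1\le j\le m$, $i\in\mathbb{Z}/n\mathbb{Z}$) with relations $$q_{j,i}q_{j',i'}=\begin{cases}\epsilon\,q_{j',i'}q_{j,i}&q_{j,i}\in S_{k+1},\ q_{j',i'}\in S_k,\ j\le j',\\ \epsilon^{-1}q_{j',i'}q_{j,i}&q_{j,i}\in S_{k+1},\ q_{j',i'}\in S_k,\ j>j',\\ \epsilon^{-2}q_{j',i'}q_{j,i}&q_{j,i},q_{j',i'}\in S_k,\ j<j',\\ \epsilon^{2}q_{j',i'}q_{j,i}&q_{j,i},q_{j',i'}\in S_k,\ j>j',\\ q_{j',i'}q_{j,i}&\text{if neither } (q_{j,i},q_{j',i'})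 \text{ nor } (q_{j',i'},q_{j,i}) \text{ is covered by the previous cases.}\end{cases}$$ Quantum geometric $R$-matrix: for $1\le j\le m-1$ write $p_i=q_{j,i}$, $q_i=q_{j+1,i}$, and $$\kappa_i^\epsilon=\sum_{h=0}^{n-1}p_{i-1}p_{i-2}\cdots p_{i-h}\,q_{i-h-2}q_{i-h-3}\cdots q_{i-n}\qquad(\text{factors in this order}).$$ $R_j^\epsilon:\mathcal{Q}_\epsilon\to\mathcal{Q}_\epsilon$ is the morphism of skew fields with $R_j^\epsilon(p_i)=(\kappa_i^\epsilon)^{-1}q_i\,\kappa_{i+1}^\epsilon$, $R_j^\epsilon(q_i)=(\kappa_{i+1}^\epsilon)^{-1}p_i\,\kappa_i^\epsilon$, fixing $\epsilon$ and all $q_{j',i}$ with $j'\ne j,j+1$. The $R_j^\epsilon$ generate an action of $\mathfrak{S}_m$ on $\mathcal{Q}_\epsilon$, and $\mathcal{Q}_\epsilon^{\mathfrak{S}_m}$ denotes the set of elements fixed by all of $R_1^\epsilon,\dots,R_{m-1}^\epsilon$. Quantum loop elementary symmetric functions: for $1\le k\le m$ and $r\in\mathbb{Z}/n\mathbb{Z}$, $$e_k^{(r)}(\mathbf{q}_1,\dots,\mathbf{q}_m)=\sum_{1\le j_1<j_2<\cdots<j_k\le m}q_{j_1}^{(r+1-j_1)}q_{j_2}^{(r+2-j_2)}\cdots q_{j_k}^{(r+k-j_k)}\in\mathcal{Q}_\epsilon,$$ and $e_k^{(r)}=0$ for $k>m$. *)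

(* Defs.v *)
From HB Require Import structures.
From mathcomp Require Import all_boot all_order all_algebra.
Set Implicit Arguments.
Unset Strict Implicit.
Unset Printing Implicit Defensive.
Import GRing.Theory.
Local Open Scope ring_scope.

(** Rows are indexed by ['I_m]: the ordinal [j] stands for the row [j.+1] of
    [1, ..., m].  Upper indices live in ['Z_n], which is Z/nZ as soon as
    [1 < n]. *)

Definition in_S (m n : nat) (k : 'Z_n) (j : 'I_m) (i : 'Z_n) : Prop :=
  i + j.+1%:R = 1 + k.

(** The ordered pair (q_{j,i}, q_{j',i'}) falls under one of the four cases with
    a nontrivial power of epsilon. *)
Definition covered (m n : nat) (j : 'I_m) (i : 'Z_n) (j' : 'I_m) (i' : 'Z_n) :
    Prop :=
  exists k : 'Z_n,
    (in_S (k + 1) j i /\ in_S k j' i') \/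
    [/\ in_S k j i, in_S k j' i' & j != j'].

Record quantum_relations (m n : nat) (B : unitRingType)
    (eps : B) (q : 'I_m -> 'Z_n -> B) : Prop := QuantumRelations {
  eps_unit : eps \is a GRing.unit;
  eps_central : forall x : B, eps * x = x * eps;
  gen_unit : forall j i, q j i \is a GRing.unit;
  rel_next_le : forall k j i j' i', in_S (k + 1) j i -> in_S k j' i' ->
    (j <= j')%N -> q j i * q j' i' = eps * (q j' i' * q j i);
  rel_next_gt : forall k j i j' i', in_S (k + 1) j i -> in_S k j' i' ->
    (j > j')%N -> q j i * q j' i' = eps^-1 * (q j' i' * q j i);
  rel_same_lt : forall k j i j' i', in_S k j i -> in_S k j' i' ->
    (j < j')%N -> q j i * q j' i' = eps ^- 2 * (q j' i' * q j i);
  rel_same_gt : forall k j i j' i', in_S k j i -> in_S k j' i' ->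
    (j > j')%N -> q j i * q j' i' = eps ^+ 2 * (q j' i' * q j i);
  rel_other : forall j i j' i', ~ covered j i j' i' -> ~ covered j' i' j i ->
    q j i * q j' i' = q j' i' * q j i
}.

(** The ring [A] is presented by a central invertible generator [eps] and
    invertible generators [q j i] subject to the relations above, i.e. it is
    initial among such rings.  This determines [(A, eps, q)] up to a unique
    isomorphism. *)
Definition is_quantum_torus (m n : nat) (A : unitRingType)
    (eps : A) (q : 'I_m -> 'Z_n -> A) : Prop :=
  quantum_relations eps q /\
  forall (B : unitRingType) (eps' : B) (q' : 'I_m -> 'Z_n -> B),
    quantum_relations eps' q' ->
    let extends (f : {rmorphism A -> B}) :=
      f eps = eps' /\ (forall j i, f (q j i) = q' j i) in
    exists2 f : {rmorphism A -> B},
      extends f & forall g : {rmorphism A -> B}, extends g -> f =1 g.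

Definition is_skew_field_of_fractions (A D : unitRingType)
    (iota : {rmorphism A -> D}) : Prop :=
  [/\ injective iota,
      forall x : D, x != 0 -> x \is a GRing.unit &
      forall x : D, exists a b : A, b != 0 /\ x = iota a / iota b].

Definition kappa (n : nat) (D : unitRingType) (p q : 'Z_n -> D) (i : 'Z_n) : D :=
  \sum_(0 <= h < n)
    (\prod_(1 <= a < h.+1) p (i - a%:R)) *
    (\prod_(h.+2 <= b < n.+1) q (i - b%:R)).

Lemma ord_pred_ltS (m : nat) (j : 'I_m.-1) : (j.+1 < m)%N.
Proof. by rewrite -ltn_predRL. Qed.

Definition row_fst (m : nat) (j : 'I_m.-1) : 'I_m := widen_ord (leq_pred m) j.
Definition row_snd (m : nat) (j : 'I_m.-1) : 'I_m := Ordinal (ord_pred_ltS j).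

(** [R] is the quantum geometric R-matrix acting on the rows [row_fst j] and
    [row_snd j]. *)
Definition is_quantum_R (m n : nat) (D : unitRingType)
    (eps : D) (q : 'I_m -> 'Z_n -> D) (j : 'I_m.-1) (R : {rmorphism D -> D}) :
    Prop :=
  let p1 := q (row_fst j) in
  let q1 := q (row_snd j) in
  let kap := kappa p1 q1 in
  [/\ R eps = eps,
      forall i, R (p1 i) = (kap i)^-1 * q1 i * kap (i + 1),
      forall i, R (q1 i) = (kap (i + 1))^-1 * p1 i * kap i &
      forall (j' : 'I_m) i, j' != row_fst j -> j' != row_snd j ->
        R (q j' i) = q j' i].

Definition fixed_by_all (I : Type) (D : unitRingType)
    (R : I -> {rmorphism D -> D}) (x : D) : Prop :=
  forall j : I, R j x = x.

(** [tnth J l] has row number [(tnth J l).+1] and is the [l.+1]-st factor; the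
    sum is empty when [m < k]. *)
Definition loop_elementary (m n : nat) (D : unitRingType)
    (q : 'I_m -> 'Z_n -> D) (k : nat) (r : 'Z_n) : D :=
  \sum_(J : k.-tuple 'I_m | sorted ltn (map val J))
    \prod_(l < k) q (tnth J l) (r + l.+1%:R - (tnth J l).+1%:R).

(* Main.v *)
Require Import Defs.
From HB Require Import structures.
From mathcomp Require Import all_boot all_order all_algebra.
From mathcomp Require Import ring zify.
Set Implicit Arguments.
Unset Strict Implicit.
Unset Printing Implicit Defensive.
Import GRing.Theory.
Local Open Scope ring_scope.

(** Let [p_i], [q_i] be the generators of two consecutive rows [j], [j + 1].
    The factors of a monomial of [e_k^(r)] that lie in these two rows are
    adjacent: there is either none, or one, or one from each row.  Reading the
    sum over all such choices, the two rows enter [e_k^(r)] only through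
    [p_i + q_(i-1)] and [p_i q_i] (lemma [eq_staircase_sum_pair]), so it is
    enough that [R_j] fixes these elements of [Q].

    With [kappa_i^-1 q_i kappa_(i+1)] and [kappa_(i+1)^-1 p_i kappa_i] for the
    images of [p_i] and [q_i], this amounts to two identities:
    - [kappa_i p_i q_i = q_i p_i kappa_i] (lemma [kappa_pq]);
    - [q_i kappa_(i+1) + p_(i-1) kappa_(i-1) = kappa_i (p_i + q_(i-1))]
      (lemma [kappa_sum]).

    Both come from one commutation.  Every term of [kappa_i] but the last one,
    which is [p_(i-1) ... p_(i-n+1)], is [w_h q_i] with
    [w_h = p_(i-1) ... p_(i-h) q_(i-h-2) ... q_(i-n+1)].  Adding up powers of
    epsilon shows that [w_h] commutes with [p_i q_i], hence with
    [q_i p_i = epsilon^-1 p_i q_i].  The first identity then holds term by term,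
    the last term being a similar count.  In the second one, the terms of
    [p_(i-1) kappa_(i-1)] and [kappa_i q_(i-1)] telescope, and the terms of
    [q_i kappa_(i+1)] and [kappa_i p_i] match up as [q_i p_i w_h = w_h q_i p_i],
    except for one term on either side.  The telescoping leaves two words: the
    one in the [p]s alone is the exceptional term of [kappa_i p_i], and the one in
    the [q]s alone becomes that of [q_i kappa_(i+1)] by moving its last two
    factors to the front, which costs no power of epsilon.

    The [kappa_i] are invertible because [R_j] maps the unit [p_i] to a unit,
    so that [kappa_i^-1 q_i kappa_(i+1)] cannot vanish. *)

(** * Commutation up to a power of epsilon *)

Definition qcomm (D : unitRingType) (eps : D) (w : int) (x y : D) : Prop :=
  x * y = eps ^ w * (y * x).

Lemma qcomm_cast (D : unitRingType) (eps : D) w w' x y :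
  qcomm eps w x y -> w = w' -> qcomm eps w' x y.
Proof. by move=> h <-. Qed.

Section QuasiCommutation.

Variables (D : unitRingType) (eps : D).
Hypotheses (eps_unit : eps \is a GRing.unit)
  (eps_central : forall x : D, eps * x = x * eps).

Lemma central_exprz (w : int) (x : D) : eps ^ w * x = x * eps ^ w.
Proof.
apply/esym; case: w => k; first exact/commrX/esym/eps_central.
exact/commrV/commrX/esym/eps_central.
Qed.

Lemma qcomm_sym (w : int) (x y : D) : qcomm eps w x y -> qcomm eps (- w) y x.
Proof.
by rewrite /qcomm => ->; rewrite mulrA -exprzDr // addNr expr0z mul1r.
Qed.

Lemma qcomm1l (y : D) : qcomm eps 0 1 y.
Proof. by rewrite /qcomm expr0z !mul1r mulr1. Qed.

Lemma qcommMl (w1 w2 : int) (x1 x2 y : D) :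
  qcomm eps w1 x1 y -> qcomm eps w2 x2 y -> qcomm eps (w1 + w2) (x1 * x2) y.
Proof.
rewrite /qcomm => h1 h2.
rewrite -mulrA h2 mulrA -central_exprz -mulrA [x1 * _]mulrA h1.
by rewrite addrC exprzDr // !mulrA.
Qed.

Lemma qcommMr (w1 w2 : int) (x y1 y2 : D) :
  qcomm eps w1 x y1 -> qcomm eps w2 x y2 -> qcomm eps (w1 + w2) x (y1 * y2).
Proof.
move=> /qcomm_sym h1 /qcomm_sym h2.
by rewrite -[w1 + w2]opprK opprD; apply/qcomm_sym/qcommMl.
Qed.

Lemma qcomm_prod (m k : nat) (w : nat -> int) (x : nat -> D) (y : D) :
  (forall a, (m <= a < k)%N -> qcomm eps (w a) (x a) y) ->
  qcomm eps (\sum_(m <= a < k) w a) (\prod_(m <= a < k) x a) y.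
Proof.
move=> h; rewrite [X in qcomm _ X _ _]big_nat [X in qcomm _ _ X _]big_nat.
apply: (big_rec2 (fun w z => qcomm eps w z y)); first exact: qcomm1l.
by move=> a v z /h ha hz; apply: qcommMl.
Qed.

End QuasiCommutation.

(** * Indices modulo n *)

Lemma natZn_eq (n a b : nat) :
  (1 < n)%N -> (a%:R == b%:R :> 'Z_n) = (a == b %[mod n]).
Proof. by move=> n_gt1; rewrite -val_eqE /= !val_Zp_nat. Qed.

Lemma subr_natZn_eq (n a b : nat) (i : 'Z_n) :
  (1 < n)%N -> (i - a%:R == i - b%:R) = (a == b %[mod n]).
Proof. by move=> n_gt1; rewrite (inj_eq (addrI i)) (inj_eq oppr_inj) natZn_eq. Qed.

Lemma addr_natZn_neq (n c : nat) (i : 'Z_n) : (0 < c < n)%N ->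
  (i == i + c%:R) = false.
Proof.
move=> /andP[c0 cn]; rewrite -[X in X == _]addr0 (inj_eq (addrI i)) -[0]/(0%:R).
by rewrite natZn_eq ?mod0n ?modn_small //; lia.
Qed.

Lemma sumz_nat_eq (m k c : nat) :
  \sum_(m <= a < k) (a == c)%:Z = (m <= c < k)%N%:Z :> int.
Proof.
rewrite (eq_bigr (fun a => if a == c then 1%:Z else 0)); last by move=> a _; case: eqP.
by rewrite -big_mkcond big_nat1_eq; case: ifP.
Qed.

Lemma sum_sub_eq (m k c d : nat) :
  \sum_(m <= a < k) ((a == c)%:Z - (a == d)%:Z) =
  (m <= c < k)%N%:Z - (m <= d < k)%N%:Z :> int.
Proof. by rewrite sumrB !sumz_nat_eq. Qed.

(** * The kappa elements of two adjacent rows *)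

(** The commutation rules of the rows [j] and [j + 1], with the case
    distinction turned into an exponent of epsilon that is a signed sum of indicators.
    In this form the exponents of words can be computed by linear arithmetic,
    and the case [n = 3], where [i + 2] and [i - 1] coincide, needs no separate
    treatment. *)
Record adjacent_rows (n : nat) (D : unitRingType) (eps : D) (p q : 'Z_n -> D) :
    Prop := AdjacentRows {
  adj_unit : eps \is a GRing.unit;
  adj_central : forall x : D, eps * x = x * eps;
  adj_pp : forall a b, qcomm eps ((a == b + 1)%:Z - (b == a + 1)%:Z) (p a) (p b);
  adj_qq : forall a b, qcomm eps ((a == b + 1)%:Z - (b == a + 1)%:Z) (q a) (q b);
  adj_pq : forall a b,
    qcomm eps ((a == b)%:Z - (a == b + 1)%:Z *+ 2 + (a == b + 2)%:Z) (p a) (q b)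
}.

Section AdjacentRows.

Variables (n : nat) (D : unitRingType) (eps : D) (p q : 'Z_n -> D).
Hypotheses (n_ge3 : (3 <= n)%N) (adj : adjacent_rows eps p q).

Let n_gt1 : (1 < n)%N := ltnW n_ge3.
Let eps_unit := adj_unit adj.
Let eps_central := adj_central adj.

Lemma subr_addr_Zn_eq (i : 'Z_n) (a c : nat) : (0 < a + c < n.*2)%N ->
  (i - a%:R == i + c%:R) = (a + c == n)%N.
Proof.
move=> /andP[ac0 acn]; rewrite -(inj_eq (addIr (- c%:R))) addrK -addrA -opprD -natrD.
rewrite -[X in _ == X]subr0 -[0 in X in _ == X]/(0%:R) subr_natZn_eq // mod0n.
have [->|ne] := eqVneq (a + c)%N n; first by rewrite modnn.
have [lt|ge] := ltnP (a + c) n; first by rewrite modn_small //; lia.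
by rewrite -(subnK ge) modnDr modn_small //; lia.
Qed.

Lemma subr1_Zn_eq (i : 'Z_n) (a : nat) : (a < n)%N ->
  (i == i - a%:R + 1) = (a == 1)%N.
Proof.
move=> an; rewrite -(inj_eq (addIr (-1))) addrK -[1]/(1%:R) subr_natZn_eq //.
by rewrite !modn_small // eq_sym.
Qed.

Lemma shift_comparisons (i : 'Z_n) (a : nat) : (0 < a < n)%N ->
  [/\ (i - a%:R == i) = false, (i == i - a%:R + 1) = (a == 1)%N,
      (i - a%:R == i + 1) = (a.+1 == n) & (i - a%:R == i + 2) = (a.+2 == n)].
Proof.
move=> /andP[a0 an]; split.
- by rewrite -[X in _ == X]addr0 -[0]/(0%:R) subr_addr_Zn_eq; lia.
- exact: subr1_Zn_eq.
- by rewrite -[1]/(1%:R) subr_addr_Zn_eq; lia.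
- by rewrite subr_addr_Zn_eq; lia.
Qed.

Lemma qcomm_p_pq (i : 'Z_n) (a : nat) : (0 < a < n)%N ->
  qcomm eps ((a.+2 == n)%:Z - (a == 1)%N%:Z - (a.+1 == n)%:Z)
    (p (i - a%:R)) (p i * q i).
Proof.
move=> /(shift_comparisons i)[e0 e1 e2 e3].
have := qcommMr eps_unit eps_central (adj_pp adj (i - a%:R) i)
  (adj_pq adj (i - a%:R) i).
by move/qcomm_cast; apply; rewrite e0 e1 e2 e3; lia.
Qed.

Lemma qcomm_q_pq (i : 'Z_n) (a : nat) : (1 < a < n)%N ->
  qcomm eps ((a.+1 == n)%:Z - (a == 2)%N%:Z) (q (i - a%:R)) (p i * q i).
Proof.
move=> /andP[a1 an]; have [|e0 e1 e2 e3] := @shift_comparisons i a; first by lia.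
have := qcommMr eps_unit eps_central
  (qcomm_sym eps_unit (adj_pq adj i (i - a%:R))) (adj_qq adj (i - a%:R) i).
have e4 : (i == i - a%:R + 2) = (a == 2)%N.
  by rewrite -(inj_eq (addIr (-2))) addrK subr_natZn_eq // !modn_small // eq_sym.
by move/qcomm_cast; apply; rewrite eq_sym e0 e1 e2 e4; lia.
Qed.

Lemma qcomm_q_qq (i : 'Z_n) (a : nat) : (1 < a < n)%N ->
  qcomm eps ((a.+1 == n)%:Z - (a == 2)%N%:Z) (q (i - a%:R)) (q i * q (i - 1)).
Proof.
move=> /andP[a1 an]; have [|e0 e1 e2 e3] := @shift_comparisons i a; first by lia.
have [|f0 f1 f2 f3] := @shift_comparisons (i - 1) a.-1; first by lia.
have e : i - 1 - a.-1%:R = i - a%:R.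
  by rewrite -addrA -opprD -(natrD _ 1) add1n prednK // ltnW.
rewrite e in f0 f1 f2 f3.
have := qcommMr eps_unit eps_central (adj_qq adj (i - a%:R) i)
  (adj_qq adj (i - a%:R) (i - 1)).
by move/qcomm_cast; apply; rewrite e1 e2 f1 f2; lia.
Qed.

(** The factor [w_h] such that the term of index [h < n - 1] of [kappa_i] is
    [w_h q_i]. *)
Definition inner_word (i : 'Z_n) (h : nat) : D :=
  (\prod_(1 <= a < h.+1) p (i - a%:R)) * (\prod_(h.+2 <= b < n) q (i - b%:R)).

(** The factors [p] contribute [-1] from [p_(i-1)], compensated by [p_(i+2)] if
    that factor is reached; the factors [q] contribute [1] from [q_(i+1)] and
    [-1] from [q_(i-2)], whenever they are present.  As [h <= n - 2], exactly
    one of [p_(i+2)], [q_(i+1)] occurs, and exactly one of [p_(i-1)],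
    [q_(i-2)]. *)
Lemma inner_word_pq (i : 'Z_n) (h : nat) : (h.+1 < n)%N ->
  qcomm eps 0 (inner_word i h) (p i * q i).
Proof.
move=> hn.
have hp : forall a, (1 <= a < h.+1)%N ->
  qcomm eps ((a == n.-2)%:Z - (a == 1)%N%:Z) (p (i - a%:R)) (p i * q i).
  move=> a ah; apply: (qcomm_cast (qcomm_p_pq _ _)); lia.
have hq : forall b, (h.+2 <= b < n)%N ->
  qcomm eps ((b == n.-1)%:Z - (b == 2)%N%:Z) (q (i - b%:R)) (p i * q i).
  move=> b bh; apply: (qcomm_cast (qcomm_q_pq _ _)); lia.
have := qcommMl eps_unit eps_central (qcomm_prod eps_unit eps_central hp)
  (qcomm_prod eps_unit eps_central hq).
by move/qcomm_cast; apply; rewrite !sum_sub_eq; lia.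
Qed.

Lemma prod_p_pq (i : 'Z_n) :
  qcomm eps (-1) (\prod_(1 <= a < n) p (i - a%:R)) (p i * q i).
Proof.
have hp : forall a, (1 <= a < n)%N ->
  qcomm eps (((a == n.-2)%:Z - (a == 1)%N%:Z) - (a == n.-1)%:Z)
    (p (i - a%:R)) (p i * q i).
  move=> a ah; apply: (qcomm_cast (qcomm_p_pq _ _)); lia.
have := qcomm_prod eps_unit eps_central hp.
by move/qcomm_cast; apply; rewrite sumrB sum_sub_eq sumz_nat_eq; lia.
Qed.

(** This is what allows the word [q_(i-2) ... q_(i-n-1)] to be rotated into
    [q_i q_(i-1) ... q_(i-n+1)] without any power of epsilon. *)
Lemma prod_q_qq (i : 'Z_n) :
  qcomm eps 0 (\prod_(2 <= b < n) q (i - b%:R)) (q i * q (i - 1)).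
Proof.
have hq : forall b, (2 <= b < n)%N ->
  qcomm eps ((b == n.-1)%:Z - (b == 2)%N%:Z) (q (i - b%:R)) (q i * q (i - 1)).
  move=> b bh; apply: (qcomm_cast (qcomm_q_qq _ _)); lia.
have := qcomm_prod eps_unit eps_central hq.
by move/qcomm_cast; apply; rewrite sum_sub_eq; lia.
Qed.

Lemma natZn_n : n%:R = 0 :> 'Z_n.
Proof. by apply/eqP; rewrite -[0]/(0%:R) natZn_eq // modnn mod0n. Qed.

Lemma natZn_nS : n.+1%:R = 1 :> 'Z_n.
Proof. by rewrite mulrSr natZn_n add0r. Qed.

(** For [h = n - 1] the [q]-part of the term is empty, so that it does not end
    with [q_i] and has to be set apart. *)
Lemma kappaE (i : 'Z_n) : kappa p q i =
  \sum_(0 <= h < n.-1) inner_word i h * q i + \prod_(1 <= a < n) p (i - a%:R).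
Proof.
have e : n = n.-1.+1 by lia.
rewrite /kappa [X in \sum_(_ <= _ < X) _]e big_nat_recr //=; congr (_ + _).
  apply: eq_big_nat => h hn; rewrite /inner_word [X in _ * X = _]big_nat_recr; last by lia.
  by rewrite /= natZn_n subr0 !mulrA.
by rewrite -e [X in _ * X]big_geq ?mulr1 //; lia.
Qed.

Lemma qq_pq (i : 'Z_n) : q i * p i = eps^-1 * (p i * q i).
Proof.
have := qcomm_sym eps_unit (adj_pq adj i i); rewrite eqxx.
have [-> ->]: (i == i + 1) = false /\ (i == i + 2) = false.
  by split; [apply: (@addr_natZn_neq n 1) | apply: (@addr_natZn_neq n 2)]; lia.
by [].
Qed.

Lemma inner_word_qp (i : 'Z_n) (h : nat) : (h.+1 < n)%N ->
  inner_word i h * (q i * p i) = q i * p i * inner_word i h.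
Proof.
move=> hn; have := inner_word_pq i hn; rewrite /qcomm expr0z mul1r qq_pq => c.
move: (inner_word i h) c => w c.
by rewrite -[RHS]mulrA -c -exprN1 !mulrA (central_exprz eps_central).
Qed.

Lemma kappa_pq (i : 'Z_n) : kappa p q i * (p i * q i) = q i * p i * kappa p q i.
Proof.
rewrite kappaE mulrDl mulrDr; congr (_ + _); last first.
  by rewrite prod_p_pq exprN1 mulrA -qq_pq.
rewrite mulr_suml mulr_sumr; apply: eq_big_nat => h hn.
have c : inner_word i h * (q i * p i) = q i * p i * inner_word i h.
  by apply: inner_word_qp; lia.
by move: (inner_word i h) c => w c; rewrite !mulrA -[w * q i * p i]mulrA c.
Qed.

Lemma kappa_sum (i : 'Z_n) :
  q i * kappa p q (i + 1) + p (i - 1) * kappa p q (i - 1) =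
  kappa p q i * (p i + q (i - 1)).
Proof.
(* The word [p_(i-1) ... p_(i-h) q_(i-h-2) ... q_(i-n-1)], for [0 <= h <= n]:
   these are the terms of [kappa_i q_(i-1)] and, with [h] shifted by one, those
   of [p_(i-1) kappa_(i-1)]. *)
pose T h := (\prod_(1 <= a < h.+1) p (i - a%:R)) *
  (\prod_(h.+2 <= b < n.+2) q (i - b%:R)).
have subS a : i - 1 - a%:R = i - a.+1%:R.
  by rewrite -addrA -opprD -(natrD _ 1) add1n.
have addS a : i + 1 - a.+1%:R = i - a%:R.
  by rewrite -[a.+1]addn1 natrD opprD addrACA subrr addr0.
have tele : \sum_(0 <= h < n) T h + T n = T 0%N + \sum_(0 <= h < n) T h.+1.
  by rewrite -big_nat_recl // -big_nat_recr.
have Ep : p (i - 1) * kappa p q (i - 1) = \sum_(0 <= h < n) T h.+1.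
  rewrite mulr_sumr; apply: eq_big_nat => h hn.
  rewrite mulrA /T [X in _ = X * _]big_ltn //.
  rewrite [X in _ = _ * X * _]big_add1 [X in _ = _ * X]big_add1 /=.
  by congr (_ * _ * _); apply: eq_bigr => a _; rewrite subS.
have Eq : kappa p q i * q (i - 1) = \sum_(0 <= h < n) T h.
  rewrite mulr_suml; apply: eq_big_nat => h hn.
  rewrite -mulrA /T [X in _ = _ * X]big_nat_recr /=; last by lia.
  by congr (_ * (_ * q _)); rewrite natZn_nS.
have EpR : kappa p q i * p i =
    \sum_(0 <= h < n.-1) inner_word i h * q i * p i + T n.
  rewrite kappaE mulrDl mulr_suml /T big_nat_recr /=; last by lia.
  by rewrite natZn_n subr0 [X in _ = _ + _ * X]big_geq ?mulr1.
have EqL : q i * kappa p q (i + 1) =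
    T 0%N + \sum_(0 <= h < n.-1) q i * p i * inner_word i h.
  have e : n = n.-1.+1 by lia.
  rewrite /kappa [X in \sum_(_ <= _ < X) _]e big_nat_recl // mulrDr.
  congr (_ + _).
    rewrite /T [X in _ * (X * _) = _]big_geq // [X in _ = X * _]big_geq // !mul1r.
    rewrite big_add1 /=; under eq_bigr do rewrite addS.
    rewrite big_ltn // !big_nat_recr //=; last by lia.
    rewrite natZn_n natZn_nS subr0 -[RHS]mulrA mulrA.
    by have := prod_q_qq i; rewrite /qcomm expr0z mul1r => ->.
  rewrite mulr_sumr; apply: eq_big_nat => h hn.
  rewrite /inner_word big_ltn // addrK -!mulrA; congr (_ * (_ * _)).
  rewrite !big_add1 /=.
  by congr (_ * _); apply: eq_bigr => a _; rewrite addS.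
rewrite mulrDr EpR Eq -addrA [T n + _]addrC tele addrA.
rewrite EqL Ep [_ + T 0%N]addrC; congr (_ + _ + _).
apply: eq_big_nat => h hn.
by rewrite -[_ * q i * p i]mulrA inner_word_qp //; lia.
Qed.

(** The two factors on the left are the images of [p_i] and [q_i] under the
    R-matrix. *)
Lemma kappa_conj_mul (i : 'Z_n) :
  kappa p q i \is a GRing.unit -> kappa p q (i + 1) \is a GRing.unit ->
  (kappa p q i)^-1 * q i * kappa p q (i + 1) *
    ((kappa p q (i + 1))^-1 * p i * kappa p q i) = p i * q i.
Proof.
move=> u u1; rewrite -!mulrA [X in _ * (_ * X)]mulVKr //.
by rewrite [q i * _]mulrA -kappa_pq mulKr.
Qed.

(** The two summands on the left are the images of [p_i] and [q_(i-1)] under the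
    R-matrix. *)
Lemma kappa_conj_add (i : 'Z_n) : kappa p q i \is a GRing.unit ->
  (kappa p q i)^-1 * q i * kappa p q (i + 1) +
    (kappa p q i)^-1 * p (i - 1) * kappa p q (i - 1) = p i + q (i - 1).
Proof. by move=> u; rewrite -!mulrA -mulrDr kappa_sum mulKr. Qed.

End AdjacentRows.

(** * Consecutive rows of the quantum torus *)

Lemma same_row_qcomm (m n : nat) (B : unitRingType) (eps : B)
    (q : 'I_m -> 'Z_n -> B) (j : 'I_m) (a b : 'Z_n) :
  (3 <= n)%N -> quantum_relations eps q ->
  qcomm eps ((a == b + 1)%:Z - (b == a + 1)%:Z) (q j a) (q j b).
Proof.
move=> n_ge3 hq; have n_gt1 : (1 < n)%N := ltnW n_ge3.
have two_neq0 (x : 'Z_n) : (x == x + 1 + 1) = false.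
  by rewrite -addrA; apply: (@addr_natZn_neq n 2); lia.
have next (x : 'Z_n) : qcomm eps 1 (q j (x + 1)) (q j x).
  rewrite /qcomm expr1z; apply: (rel_next_le hq (k := x + j.+1%:R - 1)) => //.
    by rewrite /in_S; ring.
  by rewrite /in_S; ring.
have [->|ab] := eqVneq a (b + 1).
  by rewrite two_neq0 subr0; exact: next.
have [->|ba] := eqVneq b (a + 1).
  rewrite sub0r; apply: qcomm_sym; [exact: eps_unit hq | exact: next].
have ncov x y : x != y + 1 -> ~ covered j x j y.
  move=> /eqP xy [k [[h1 h2]|[_ _ /eqP//]]]; apply: xy.
  apply: (addIr j.+1%:R); rewrite addrAC h2 h1; ring.
by rewrite subrr /qcomm expr0z mul1r; apply: (rel_other hq); apply: ncov.
Qed.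

Lemma consecutive_rows_adjacent (m n : nat) (B : unitRingType) (eps : B)
    (q : 'I_m -> 'Z_n -> B) (j j' : 'I_m) :
  (3 <= n)%N -> quantum_relations eps q -> j' = j.+1 :> nat ->
  adjacent_rows eps (q j) (q j').
Proof.
move=> n_ge3 hq jj'; have n_gt1 : (1 < n)%N := ltnW n_ge3.
have eps_u := eps_unit hq; have jltj' : (j < j')%N by rewrite jj'.
have row_eq : j'.+1%:R = j.+1%:R + 1 :> 'Z_n by rewrite jj' [RHS]addrC -mulrS.
split=> //; first exact: eps_central hq.
- by move=> a b; apply: same_row_qcomm.
- by move=> a b; apply: same_row_qcomm.
move=> a b.
have one_neq0 (x : 'Z_n) : (x == x + 1) = false.
  by apply: (@addr_natZn_neq n 1); lia.
have two_neq0 (x : 'Z_n) : (x == x + 2) = false.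
  by apply: (@addr_natZn_neq n 2); lia.
have [<-|ab] := eqVneq a b.
  rewrite one_neq0 two_neq0 mul0rn subr0 addr0 -[1%:Z]opprK; apply: qcomm_sym => //.
  rewrite /qcomm exprN1.
  by apply: (rel_next_gt hq (k := a + j.+1%:R - 1)) => //; rewrite /in_S ?row_eq; ring.
have [->|ab1] := eqVneq a (b + 1).
  have -> : (b + 1 == b + 2) = false by rewrite (natrD _ 1 1) addrA one_neq0.
  rewrite sub0r addr0 /qcomm.
  by apply: (rel_same_lt hq (k := b + j.+1%:R)) => //; rewrite /in_S ?row_eq; ring.
have [->|ab2] := eqVneq a (b + 2).
  rewrite subrr add0r /qcomm expr1z.
  by apply: (rel_next_le hq (k := b + j.+1%:R)) => //;
    rewrite /in_S ?row_eq ?(ltnW jltj') //; ring.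
apply: (@qcomm_cast _ _ 0) => //; rewrite /qcomm expr0z mul1r; apply: (rel_other hq).
  rewrite /covered /in_S row_eq => -[k [[h1 h2]|[h1 h2 _]]].
    by move/eqP: ab2; apply; apply: (addIr j.+1%:R); rewrite h1 -[k](addKr 1) -h2; ring.
  by move/eqP: ab1; apply; apply: (addIr j.+1%:R); rewrite h1 -h2; ring.
rewrite /covered /in_S row_eq => -[k [[h1 h2]|[h1 h2 _]]].
  by move/eqP: ab; apply; apply: (addIr j.+1%:R); rewrite h2; apply: (addIr 1);
    rewrite -[RHS]addrA h1; ring.
by move/eqP: ab1; apply; apply: (addIr j.+1%:R); rewrite h2 -h1; ring.
Qed.

(** Only the centrality of epsilon is not immediate: it commutes with the
    numerator and with the denominator of every fraction. *)
Lemma quantum_relations_fractions (m n : nat) (A Q : unitRingType) (eps : A)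
    (q : 'I_m -> 'Z_n -> A) (iota : {rmorphism A -> Q}) :
  quantum_relations eps q -> is_skew_field_of_fractions iota ->
  quantum_relations (iota eps) (fun j i => iota (q j i)).
Proof.
move=> hq [iota_inj Q_unit Q_frac]; have eps_u := eps_unit hq; split.
- exact: rmorph_unit.
- move=> x; have [a [b [b0 ->]]] := Q_frac x.
  have b_u : iota b \is a GRing.unit.
    by apply: Q_unit; rewrite -(rmorph0 iota) (inj_eq iota_inj).
  have c y : GRing.comm (iota eps) (iota y).
    by rewrite /GRing.comm -!rmorphM (eps_central hq).
  by apply: commrM; [exact: c | apply: commrV].
- by move=> j i; apply/rmorph_unit/(gen_unit hq).
- by move=> k j i j' i' h1 h2 h3; rewrite -!rmorphM (rel_next_le hq h1 h2 h3).
- move=> k j i j' i' h1 h2 h3.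
  by rewrite -rmorphV // -!rmorphM (rel_next_gt hq h1 h2 h3).
- move=> k j i j' i' h1 h2 h3.
  by rewrite -rmorphXn -rmorphV ?unitrX // -!rmorphM (rel_same_lt hq h1 h2 h3).
- move=> k j i j' i' h1 h2 h3.
  by rewrite -rmorphXn -!rmorphM (rel_same_gt hq h1 h2 h3).
- by move=> j i j' i' h1 h2; rewrite -!rmorphM (rel_other hq h1 h2).
Qed.

(** * Loop elementary symmetric functions row by row *)

Section StaircaseSum.

Variables (n : nat) (D : unitRingType) (I : eqType).

(** The sum over the [k]-element subsequences [j_1, ..., j_k] of [s] of the words
    [X j_1 r * X j_2 (r + 1) * ... * X j_k (r + k - 1)], computed by deciding for
    each row in turn whether it is used.  It is the entry [(r, r + k)] of the
    coefficient of [t^k] in the product over [s] of the transfer matrices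
    [1 + t M_j], where [M_j] has the entry [X j i] at [(i, i + 1)]. *)
Fixpoint staircase_sum (X : I -> 'Z_n -> D) (s : seq I) (k : nat) (r : 'Z_n) : D :=
  match s, k with
  | _, 0 => 1
  | [::], _.+1 => 0
  | j :: s', k'.+1 =>
      staircase_sum X s' k r + X j r * staircase_sum X s' k' (r + 1)
  end.

Lemma staircase_sum0 X s r : staircase_sum X s 0 r = 1.
Proof. by case: s. Qed.

Lemma rmorph_staircase_sum (f : {rmorphism D -> D}) X s k r :
  f (staircase_sum X s k r) = staircase_sum (fun j i => f (X j i)) s k r.
Proof.
elim: s k r => [|j s IHs] [|k] r /=; rewrite ?rmorph1 ?rmorph0 //.
by rewrite rmorphD rmorphM !IHs.
Qed.

Lemma eq_staircase_sum X Y s k r : (forall j, j \in s -> X j =1 Y j) ->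
  staircase_sum X s k r = staircase_sum Y s k r.
Proof.
elim: s k r => [|j s IHs] [|k] r //= eqXY; rewrite eqXY ?mem_head // !IHs // => l ls;
  by apply: eqXY; rewrite in_cons ls orbT.
Qed.

Lemma staircase_sum_pair X a b s k r :
  staircase_sum X [:: a, b & s] k.+1 r =
  staircase_sum X s k.+1 r + (X a r + X b r) * staircase_sum X s k (r + 1) +
  (if k is k'.+1 then X a r * X b (r + 1) * staircase_sum X s k' (r + 1 + 1) else 0).
Proof.
case: k => [|k] /=; first by rewrite !staircase_sum0 !mulr1 addr0 -addrA [X b r + _]addrC.
by rewrite mulrDl mulrDr !mulrA -!addrA [X b r * _ + _]addrCA.
Qed.

(** As words respect the order of the rows, the factors taken from two
    consecutive rows [a], [b] are adjacent; summed over the possible choices at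
    position [i], they amount to [1], [X a i + X b i] or
    [X a i * X b (i + 1)]. *)
Lemma eq_staircase_sum_pair X Y s1 a b s2 k r :
  (forall j, j \in s1 ++ s2 -> X j =1 Y j) ->
  (forall i, X a i + X b i = Y a i + Y b i) ->
  (forall i, X a i * X b (i + 1) = Y a i * Y b (i + 1)) ->
  staircase_sum X (s1 ++ [:: a, b & s2]) k r =
  staircase_sum Y (s1 ++ [:: a, b & s2]) k r.
Proof.
move=> eqXY eq_add eq_mul.
elim: s1 eqXY k r => [|j s1 IHs] eqXY [|k] r; rewrite ?staircase_sum0 //; last first.
  have eqj : X j =1 Y j by apply: eqXY; rewrite mem_head.
  by rewrite /= eqj !IHs // => l ls; apply: eqXY; rewrite in_cons ls orbT.
rewrite /cat !staircase_sum_pair eq_add !(eq_staircase_sum _ _ eqXY).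
by case: k => // k; rewrite eq_mul (eq_staircase_sum _ _ eqXY).
Qed.

End StaircaseSum.

(** A nonempty increasing tuple with entries in [j :: s] either starts with [j],
    and then its tail lives in [s], or has all its entries in [s]. *)
Lemma sum_sorted_tuples (n m : nat) (D : unitRingType) (X : 'I_m -> 'Z_n -> D)
    (s : seq 'I_m) (k : nat) (r : 'Z_n) :
  sorted ltn (map val s) ->
  \sum_(J : k.-tuple 'I_m | sorted ltn (map val J) && all (mem s) J)
    \prod_(l < k) X (tnth J l) (r + l%:R) = staircase_sum X s k r.
Proof.
elim: s k r => [|j s IHs] [|k] r s_sorted.
- rewrite (big_pred1 [tuple]) ?big_ord0 // => J /=.
  by rewrite [J]tuple0 /= eqxx.
- by rewrite big_pred0 //= => J; case/tupleP: J => x J /=; rewrite andbF.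
- rewrite (big_pred1 [tuple]) ?big_ord0 // => J /=.
  by rewrite [J]tuple0 /= eqxx.
have s_sorted' : sorted ltn (map val s) := path_sorted s_sorted.
have j_lt x : x \in s -> (j < x)%N.
  move: s_sorted; rewrite /= (path_sortedE ltn_trans) => /andP[/allP h _] xs.
  exact/h/map_f.
rewrite (bigID (fun J : k.+1.-tuple 'I_m => thead J == j)) /= addrC; congr (_ + _).
  rewrite -(IHs _ _ s_sorted'); apply: eq_bigl => J.
  case/tupleP: J => x J; rewrite theadE /=.
  case: (boolP (path _ _ _)) => //=.
  rewrite (path_sortedE ltn_trans) => /andP[/allP x_lt _].
  rewrite in_cons; have [->|xj] := eqVneq x j.
    rewrite andbF; apply/esym/negbTE; apply/nandP; left.
    by apply/negP => /j_lt; rewrite ltnn.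
  rewrite andbT /=; case: (boolP (x \in s)) => //= xs.
  apply: eq_in_all => y yJ; rewrite -[LHS]/(y \in j :: s) in_cons.
  case: eqVneq => //= yj.
  have := x_lt (val y) (map_f _ yJ); have := j_lt _ xs.
  by rewrite yj => /ltn_trans h /h; rewrite ltnn.
rewrite -(IHs _ _ s_sorted') mulr_sumr.
rewrite (reindex_onto (fun J : k.-tuple 'I_m => [tuple of j :: J])
  (fun J : k.+1.-tuple 'I_m => [tuple of behead J])) /=; last first.
  by move=> J /andP[_ /eqP <-]; rewrite -tuple_eta.
apply: eq_big => J.
  rewrite theadE eqxx andbT mem_head /=.
  have -> : [tuple of behead [tuple of j :: J]] == J by apply/eqP/val_inj.
  rewrite andbT (path_sortedE ltn_trans) -andbA.
  case: (boolP (all (mem s) J)) => [/allP Js|nJs].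
    rewrite !andbT; have -> : all (ltn j) (map val J).
      by apply/allP => _ /mapP[y yJ ->]; apply/j_lt/Js.
    rewrite /=; case: (sorted _ _) => //=; apply/allP => y yJ.
    by suff: y \in j :: s by []; rewrite in_cons orbC [y \in s]Js.
  rewrite !andbF; apply/negbTE; apply: contra nJs => /and3P[/allP h _ /allP Js].
  apply/allP => y yJ; have : y \in j :: s := Js y yJ; rewrite in_cons => /orP[/eqP yj|//].
  by have := h (val y) (map_f _ yJ); rewrite yj /= ltnn.
move=> _; rewrite big_ord_recl tnth0 addr0; congr (_ * _).
apply: eq_bigr => l _; rewrite tnthS; congr X.
by rewrite /= /bump leq0n natrD addrA.
Qed.

(** The upper index [r + l - j_l] of the [l]-th factor is [(r + l - 1) - (j_l - 1)],
    and the ordinal [j] stands for the row [j + 1]: with [X j i = q j (i - j)] the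
    upper index becomes a position advancing by one at each factor. *)
Lemma loop_elementaryE (m n : nat) (D : unitRingType) (q : 'I_m -> 'Z_n -> D)
    (k : nat) (r : 'Z_n) :
  loop_elementary q k r =
  staircase_sum (fun j i => q j (i - j%:R)) (enum 'I_m) k r.
Proof.
rewrite -sum_sorted_tuples; last by rewrite val_enum_ord iota_ltn_sorted.
apply: eq_big => J.
  have -> : all (mem (enum 'I_m)) J by apply/allP => y _; exact: mem_enum.
  by rewrite andbT.
move=> _; apply: eq_bigr => l _; congr q.
by rewrite (mulrSr 1 l) (mulrSr 1 (tnth J l)) addrA opprD addrACA subrr addr0.
Qed.

Lemma enum_ord_consecutive (m : nat) (a b : 'I_m) : b = a.+1 :> nat ->
  enum 'I_m = take a (enum 'I_m) ++ [:: a, b & drop a.+2 (enum 'I_m)].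
Proof.
move=> ba; rewrite -[LHS](cat_take_drop a) (drop_nth a) ?size_enum_ord //.
by rewrite (drop_nth b) ?size_enum_ord -?ba // ?nth_ord_enum.
Qed.

(** * Invariance under the quantum R-matrices *)

(** Otherwise the inverse of [kappa_i], being that of 0, would be 0, and so would
    be the image of the unit [p_i]. *)
Lemma kappa_unit (n m : nat) (Q : unitRingType) (eps : Q) (q : 'I_m -> 'Z_n -> Q)
    (j : 'I_m.-1) (R : {rmorphism Q -> Q}) (i : 'Z_n) :
  (forall x : Q, x != 0 -> x \is a GRing.unit) ->
  (forall j i, q j i \is a GRing.unit) -> is_quantum_R eps q j R ->
  kappa (q (row_fst j)) (q (row_snd j)) i \is a GRing.unit.
Proof.
move=> Q_unit q_unit [_ Rp _ _]; apply: Q_unit; apply/eqP => k0.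
have := rmorph_unit R (q_unit (row_fst j) i).
by rewrite Rp k0 invr0 !mul0r unitr0.
Qed.

Theorem corollary6p3 (n m : nat) (hn : (3 <= n)%N) (hm : (2 <= m)%N)
    (A : unitRingType) (eps : A) (q : 'I_m -> 'Z_n -> A)
    (hA : is_quantum_torus eps q)
    (Q : unitRingType) (iota : {rmorphism A -> Q})
    (hQ : is_skew_field_of_fractions iota)
    (R : 'I_m.-1 -> {rmorphism Q -> Q})
    (hR : forall j : 'I_m.-1,
        is_quantum_R (iota eps) (fun j' i => iota (q j' i)) j (R j))
    (k : nat) (hk : (0 < k)%N) (r : 'Z_n) :
  fixed_by_all R (loop_elementary (fun j i => iota (q j i)) k r).
Proof.
move=> j; have hq := quantum_relations_fractions hA.1 hQ.
have [_ Q_unit _] := hQ; have [_ Rp Rq R_other] := hR j.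
have ku i := kappa_unit i Q_unit (gen_unit hq) (hR j).
have adj := @consecutive_rows_adjacent _ _ _ _ _ (row_fst j) (row_snd j) hn hq erefl.
have e := @enum_ord_consecutive m (row_fst j) (row_snd j) erefl.
rewrite loop_elementaryE rmorph_staircase_sum e.
(* The image under [R j] is the staircase sum of the images, so it remains to
   compare the data of the rows; those other than the two rows of [R j] are
   fixed. *)
apply: eq_staircase_sum_pair => [l ls i | i | i].
- have := enum_uniq 'I_m; rewrite e.
  rewrite (perm_uniq (s2 := [:: row_fst j, row_snd j &
    take (row_fst j) (enum 'I_m) ++ drop (row_fst j).+2 (enum 'I_m)])).
    rewrite /= in_cons negb_or => /and3P[/andP[_ nfst] nsnd _].
    by rewrite R_other //; [apply: contraNneq nfst | apply: contraNneq nsnd] => <-.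
  by rewrite perm_catC /= !perm_cons perm_catC.
- have -> : i - (row_snd j)%:R = i - (row_fst j)%:R - 1.
    by rewrite /= (mulrSr 1 j) opprD addrA.
  by rewrite Rp Rq subrK (kappa_conj_add hn adj).
- have -> : i + 1 - (row_snd j)%:R = i - (row_fst j)%:R.
    by rewrite /= (mulrSr 1 j) opprD addrACA subrr addr0.
  by rewrite Rp Rq (kappa_conj_mul hn adj).
Qed.
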